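(* (Progress for SNAX.) Let $\Omega$ be a configuration and $\Delta$ a configuration context, as defined in the context. If $\cdot\vDash\Omega::\Delta$, then either $\Omega$ is final, or $\Omega\mapsto\Omega'$ for some configuration $\Omega'$.
   Context: This is the type theory SNAX. **Addresses.** Projections are generated by $p ::= \pi_1 \mid \pi_2 \mid \langle \ell\rangle \mid p_1\cdot p_2$, with $\cdot$ associative. Addresses are generated by $a ::= x \mid \alpha \mid a\cdot p$, where $x$ is a static variable and $\alpha$ a runtime address. We write $a \sqsupset c$ if $a = c\cdot p$ for some projection $p$, and $a \sqsupseteq c$ if $a = c$ or $a \sqsupset c$. **Types and signature.** $A ::= A_1\otimes A_2 \mid \mathbf{1} \mid \oplus\{\ell : A_\ell\}_{\ell\in L} \mid {\downarrow}A \mid A_1 \to A_2 \mid t$. A fixed signature $\Sigma$ contains: - contractive, equirecursive type definitions $t=A$, with recursion guarded by ${\downarrow}$ or $\to$; - contractive process definitions $p(z{:}C)(x_1{:}A_1)\cdots(x_n{:}A_n)=P$. **Processes.** $P,Q ::= \mathsf{cut}\,x\,P\,Q \mid \mathsf{snip}\,a\,P\,Q \mid \mathsf{copy}\,a\,b \mid \mathsf{write}\,a\,S \mid \mathsf{read}\,a\,T \mid \mathsf{call}\,p\,d\,a_1\ldots a_n$. Storables are $S ::= \langle\rangle \mid () \mid k \mid {\downarrow}a \mid (\langle x,z\rangle \Rightarrow P)$. Co-storables are $T ::= (\langle\rangle\Rightarrow P) \mid (()\Rightarrow P) \mid (\ell \Rightarrow P_\ell)_{\ell\in L} \mid ({\downarrow}x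 \Rightarrow P) \mid \langle a_1,a_2\rangle$. **Contexts and process typing.** A context $\Gamma$ is a finite list, taken up to reordering, of ordinary entries $a{:}A$ and eligible entries $\underline{a{:}A}$. The judgment is $\Gamma\vdash P :: (a:A)$. It presupposes that $a \not\sqsupseteq b$ for every ordinary $b{:}B\in\Gamma$. In the left rules for $\otimes$, $\oplus$ and ${\downarrow}$, the principal entry may be ordinary or eligible. - (W) From $\Gamma\vdash P::(c:C)$ infer $\Gamma, a{:}A\vdash P::(c:C)$, for ordinary entries only. - (C) From $\Gamma,a{:}A,a{:}A$ infer $\Gamma,a{:}A$, with the same process and destination. - (C$_E$) From $\Gamma,\underline{a{:}A},a{:}A$ infer $\Gamma,\underline{a{:}A}$, with the same process and destination. - (CUT) From $\Gamma_1\vdash P::(x:A)$ and $\Gamma_2,x{:}A\vdash Q::(c:C)$, with $x$ fresh, infer $\Gamma_1,\Gamma_2\vdash \mathsf{cut}\,x\,P\,Q::(c:C)$. - (SNIP) From $\Gamma_1\vdash P::(a:A)$ and $\Gamma_2,\underline{a{:}A}\vdash Q::(c:C)$ infer $\Gamma_1,\Gamma_2\vdash\mathsf{snip}\,a\,P\,Q::(c:C)$. - (ID) $b{:}A\vdash \mathsf{copy}\,a\,b::(a:A)$. - ($\otimes$ axiom) $\underline{a\cdot\pi_1{:}A_1},\underline{a\cdot\pi_2{:}A_2}\vdash \mathsf{write}\,a\,\langle\rangle::(a:A_1\otimes A_2)$. - ($\otimes$ left) From $\Gamma,a\cdot\pi_1{:}A_1,a\cdot\pi_2{:}A_2\vdash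 P::(c:C)$ infer $\Gamma,a{:}A_1\otimes A_2\vdash\mathsf{read}\,a\,(\langle\rangle\Rightarrow P)::(c:C)$. - ($\mathbf{1}$ axiom) $\cdot\vdash\mathsf{write}\,a\,()::(a:\mathbf{1})$. - ($\mathbf{1}$ left) From $\Gamma\vdash P::(c:C)$ infer $\Gamma,a{:}\mathbf 1\vdash \mathsf{read}\,a\,(()\Rightarrow P)::(c:C)$. - ($\oplus$ axiom) For $k\in L$: $\underline{a\cdot\langle k\rangle{:}A_k}\vdash\mathsf{write}\,a\,k::(a:\oplus\{\ell:A_\ell\}_{\ell\in L})$. - ($\oplus$ left) From $\Gamma,a\cdot\langle\ell\rangle{:}A_\ell\vdash P_\ell::(c:C)$ for all $\ell\in L$ infer $\Gamma,a{:}\oplus\{\ell:A_\ell\}_{\ell\in L}\vdash\mathsf{read}\,a\,(\ell\Rightarrow P_\ell)_{\ell\in L}::(c:C)$. - (${\downarrow}$ axiom) $b{:}A\vdash\mathsf{write}\,a\,({\downarrow}b)::(a:{\downarrow}A)$. - (${\downarrow}$ left) From $\Gamma,x{:}A\vdash P::(c:C)$ infer $\Gamma,a{:}{\downarrow}A\vdash\mathsf{read}\,a\,({\downarrow}x\Rightarrow P)::(c:C)$. - ($\to$ right) From $\Gamma,x{:}A_1\vdash P::(z:A_2)$, with $x,z$ fresh, infer $\Gamma\vdash\mathsf{write}\,a\,(\langle x,z\rangle\Rightarrow P)::(a:A_1\to A_2)$. - ($\to$ axiom) $a{:}A_1\to A_2,a_1{:}A_1\vdash\mathsf{read}\,a\,\langle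 a_1,a_2\rangle::(a_2:A_2)$. - (CALL) If $p(z{:}C)(x_1{:}A_1)\cdots(x_n{:}A_n)=P$ is in $\Sigma$, then $a_1{:}A_1,\ldots,a_n{:}A_n\vdash\mathsf{call}\,p\,c\,a_1\ldots a_n::(c:C)$. **Configurations.** Configurations are generated by $\Omega ::= \cdot \mid \Omega_1,\Omega_2 \mid \mathsf{thread}(a,P),\mathsf{cell}(a,\_) \mid \mathsf{cell}(a,S)$. Here $\mathsf{thread}(a,P)$ is a running process with destination $a$, $\mathsf{cell}(a,\_)$ is an allocated but empty cell, and $\mathsf{cell}(a,S)$ is a filled cell. All addresses in a configuration are runtime addresses, i.e. they contain no static variables. A configuration is final if it consists only of filled cells $\mathsf{cell}(a,S)$. A configuration context $\Delta$ is a list of entries $a{:}A$ with distinct runtime addresses and no eligibility. Write $\Delta\vDash_c\Gamma$ iff all of the following hold: 1. every ordinary $a{:}A\in\Gamma$ has $a{:}A\in\Delta$; 2. every $\underline{a{:}A}\in\Gamma$ has $a{:}A\in\Delta$ and $a\sqsupset c$; 3. whenever $a{:}A\in\Delta$ and $a\sqsupset c$, either $\underline{a{:}A}\in\Gamma$ or $a\sqsupset b$ for some $\underline{b{:}B}\in\Gamma$. **Configuration typing** $\Delta\vDash\Omega::\Delta'$ is given by the rules: - $\Delta\vDash\cdot::\Delta$; - from $\Delta\vDash\Omega_1::\Delta'$ and $\Delta'\vDash\Omega_2::\Delta''$ infer $\Delta\vDash\Omega_1,\Omega_2::\Delta''$; - from $a\notin\mathrm{dom}(\Delta)$, $\Delta\vDash_a\Gamma$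 and $\Gamma\vdash P::(a:A)$ infer $\Delta\vDash\mathsf{thread}(a,P),\mathsf{cell}(a,\_)::(\Delta,a{:}A)$; - from $a\notin\mathrm{dom}(\Delta)$, $\Delta\vDash_a\Gamma$ and $\Gamma\vdash\mathsf{write}\,a\,S::(a:A)$ infer $\Delta\vDash\mathsf{cell}(a,S)::(\Delta,a{:}A)$. **Operational semantics.** The step relation $\Omega\mapsto\Omega'$ rewrites a sub-multiset of the configuration, leaving the rest unchanged. Filled cells read on the left persist on the right. - $\mathsf{thread}(c,\mathsf{cut}\,x\,P\,Q)\mapsto\mathsf{thread}(\alpha,[\alpha/x]P),\mathsf{cell}(\alpha,\_),\mathsf{thread}(c,[\alpha/x]Q)$, where $\alpha$ is fresh. - $\mathsf{thread}(c,\mathsf{snip}\,a\,P\,Q)\mapsto\mathsf{thread}(a,P),\mathsf{cell}(a,\_),\mathsf{thread}(c,Q)$, provided $\mathrm{dest}(P)=\{a\}$. - $\mathsf{thread}(a,\mathsf{copy}\,a\,b),\mathsf{cell}(b,S)\mapsto\mathsf{cell}(a,S)$, with $\mathsf{cell}(b,S)$ persisting. - $\mathsf{thread}(a,\mathsf{write}\,a\,S),\mathsf{cell}(a,\_)\mapsto\mathsf{cell}(a,S)$. - $\mathsf{thread}(c,\mathsf{read}\,a\,T),\mathsf{cell}(a,S)\mapsto\mathsf{thread}(c,S\rhd T)$, with $\mathsf{cell}(a,S)$ persisting. - $\mathsf{thread}(c,\mathsf{call}\,p\,c\,a_1\ldots a_n)\mapsto\mathsf{thread}(c,[c/z,a_1/x_1,\ldots,a_n/x_n]P)$,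 where $p(z)(x_1)\cdots(x_n)=P$ in $\Sigma$. Here $S\rhd T$ is defined by: - $\langle\rangle\rhd(\langle\rangle\Rightarrow P)=P$; - $()\rhd(()\Rightarrow P)=P$; - $k\rhd(\ell\Rightarrow P_\ell)_{\ell\in L}=P_k$ for $k\in L$; - ${\downarrow}a\rhd({\downarrow}x\Rightarrow P)=[a/x]P$; - $(\langle x,z\rangle\Rightarrow P)$ combined with $\langle a_1,a_2\rangle$ gives $[a_1/x,a_2/z]P$. The function $\mathrm{dest}$ is defined by: - $\mathrm{dest}(\mathsf{cut}\,x\,P\,Q)=\mathrm{dest}(\mathsf{snip}\,a\,P\,Q)=\mathrm{dest}(Q)$; - $\mathrm{dest}(\mathsf{copy}\,a\,b)=\mathrm{dest}(\mathsf{write}\,a\,S)=\{a\}$; - $\mathrm{dest}(\mathsf{read}\,a\,(\langle\rangle\Rightarrow P))=\mathrm{dest}(\mathsf{read}\,a\,(()\Rightarrow P))=\mathrm{dest}(\mathsf{read}\,a\,({\downarrow}x\Rightarrow P))=\mathrm{dest}(P)$; - $\mathrm{dest}(\mathsf{read}\,a\,(\ell\Rightarrow P_\ell)_{\ell\in L})=\bigcup_\ell\mathrm{dest}(P_\ell)$; - $\mathrm{dest}(\mathsf{read}\,a\,\langle a_1,a_2\rangle)=\{a_2\}$.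
   Formalization: Index sets L of sums and case branches are taken nonempty (with empty L, dest of the read is empty and a well-typed snip can be stuck); dest(call p d ...) is set to {d}, and the copy step also consumes the empty cell of its destination, both left unspecified. *)

(* Defs.v *)
From Stdlib Require Import List Permutation.
Import ListNotations.

Set Implicit Arguments.

(** ** Addresses *)

Definition label := nat.

(* Index sets L are finite and nonempty.  With an empty index set,
   [read a (l => P_l)_{l in L}] would have an empty set of destinations, and the
   side condition dest(P) = {a} on reducing [snip a P Q] could fail on
   well-typed processes. *)
Record labels := Labels
  { label_list : list label;
    labels_nonempty : label_list <> [] }.

Definition in_labels (l : label) (L : labels) : Prop := In l (label_list L).

Inductive prim := Pi1 | Pi2 | PLab (l : label).

(* As juxtaposition of projections is associative, a projection is a nonempty
   list of primitive ones, and an address is a root followed by a list. *)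
Definition atom := nat.

(* [V] is the type of static variables in scope, as in nested de Bruijn syntax:
   binders extend [V] to [option V], with [None] the variable just bound.
   Runtime addresses are the elements of [addr Empty_set]. *)
Record addr (V : Type) := Addr
  { root : V + atom;
    path : list prim }.

Definition var {V : Type} (x : V) : addr V := Addr (inl x) [].
Definition runtime {V : Type} (alpha : atom) : addr V := Addr (inr alpha) [].

Definition proj {V : Type} (a : addr V) (p : list prim) : addr V :=
  Addr (root a) (path a ++ p).

Definition strictly_extends {V : Type} (a c : addr V) : Prop :=
  exists p, p <> [] /\ a = proj c p.

Definition extends {V : Type} (a c : addr V) : Prop :=
  a = c \/ strictly_extends a c.

Definition asubst {V W : Type} (s : V -> addr W) (a : addr V) : addr W :=
  match root a with
  | inl x => proj (s x) (path a)
  | inr alpha => Addr (inr alpha) (path a)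
  end.

Definition aweak {V : Type} (a : addr V) : addr (option V) :=
  asubst (fun x => var (Some x)) a.

(** ** Types *)

(* [tn] is the type of type names.  In [Plus L A] only the values of [A] on [L]
   are relevant; likewise for [KCase] below. *)
Inductive ty (tn : Type) : Type :=
| Tensor (A1 A2 : ty tn)
| One
| Plus (L : labels) (A : label -> ty tn)
| Down (A : ty tn)
| Arrow (A1 A2 : ty tn)
| TName (t : tn).

Arguments One {tn}.

(** ** Processes *)

(* [pn] is the type of process names. *)
Inductive proc (pn : Type) (V : Type) : Type :=
| Cut (P Q : proc pn (option V))
| Snip (a : addr V) (P Q : proc pn V)
| Copy (a b : addr V)
| Write (a : addr V) (S : stor pn V)
| Read (a : addr V) (T : costor pn V)
| Call (p : pn) (d : addr V) (args : list (addr V))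
with stor (pn : Type) (V : Type) : Type :=
| SPair
| SUnit
| SLabel (k : label)
| SDown (a : addr V)
| SFun (P : proc pn (option (option V))) (* <x,z> => P: x = Some None, z = None *)
with costor (pn : Type) (V : Type) : Type :=
| KPair (P : proc pn V)
| KUnit (P : proc pn V)
| KCase (L : labels) (P : label -> proc pn V)
| KDown (P : proc pn (option V))
| KApp (a1 a2 : addr V).

Arguments Copy {pn V}.
Arguments Call {pn V}.
Arguments SPair {pn V}.
Arguments SUnit {pn V}.
Arguments SLabel {pn V}.
Arguments SDown {pn V}.
Arguments KApp {pn V}.

Definition lift {V W : Type} (s : V -> addr W) (v : option V) : addr (option W) :=
  match v with
  | None => var None
  | Some x => aweak (s x)
  end.

Fixpoint psubst {pn V W : Type} (s : V -> addr W) (P : proc pn V) {struct P}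
  : proc pn W :=
  match P with
  | Cut P Q => Cut (psubst (lift s) P) (psubst (lift s) Q)
  | Snip a P Q => Snip (asubst s a) (psubst s P) (psubst s Q)
  | Copy a b => Copy (asubst s a) (asubst s b)
  | Write a St => Write (asubst s a) (ssubst s St)
  | Read a T => Read (asubst s a) (ksubst s T)
  | Call p d args => Call p (asubst s d) (map (asubst s) args)
  end
with ssubst {pn V W : Type} (s : V -> addr W) (S : stor pn V) {struct S}
  : stor pn W :=
  match S with
  | SPair => SPair
  | SUnit => SUnit
  | SLabel k => SLabel k
  | SDown a => SDown (asubst s a)
  | SFun P => SFun (psubst (lift (lift s)) P)
  end
with ksubst {pn V W : Type} (s : V -> addr W) (T : costor pn V) {struct T}
  : costor pn W :=
  match T with
  | KPair P => KPair (psubst s P)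
  | KUnit P => KUnit (psubst s P)
  | KCase L P => KCase L (fun l => psubst s (P l))
  | KDown P => KDown (psubst (lift s) P)
  | KApp a1 a2 => KApp (asubst s a1) (asubst s a2)
  end.

Definition inst1 {V : Type} (a : addr V) (v : option V) : addr V :=
  match v with
  | None => a
  | Some x => var x
  end.

Definition inst2 {V : Type} (a1 a2 : addr V) (v : option (option V)) : addr V :=
  match v with
  | None => a2
  | Some None => a1
  | Some (Some x) => var x
  end.

(* [dest P b] says that b is an element of dest(P).  A call writes to its first
   address argument. *)
Fixpoint dest {pn V : Type} (P : proc pn V) {struct P} : addr V -> Prop :=
  match P with
  | Cut _ Q => fun b => dest Q (aweak b)
  | Snip _ _ Q => dest Q
  | Copy a _ => fun b => b = a
  | Write a _ => fun b => b = a
  | Read _ T => kdest T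
  | Call _ d _ => fun b => b = d
  end
with kdest {pn V : Type} (T : costor pn V) {struct T} : addr V -> Prop :=
  match T with
  | KPair P => dest P
  | KUnit P => dest P
  | KCase L P => fun b => exists l, in_labels l L /\ dest (P l) b
  | KDown P => fun b => dest P (aweak b)
  | KApp _ a2 => fun b => b = a2
  end.

Definition aoccurs {V : Type} (alpha : atom) (a : addr V) : Prop :=
  root a = inr alpha.

Fixpoint poccurs {pn V : Type} (alpha : atom) (P : proc pn V) {struct P} : Prop :=
  match P with
  | Cut P Q => poccurs alpha P \/ poccurs alpha Q
  | Snip a P Q => aoccurs alpha a \/ poccurs alpha P \/ poccurs alpha Q
  | Copy a b => aoccurs alpha a \/ aoccurs alpha b
  | Write a St => aoccurs alpha a \/ soccurs alpha St
  | Read a T => aoccurs alpha a \/ koccurs alpha T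
  | Call _ d args => aoccurs alpha d \/ Exists (aoccurs alpha) args
  end
with soccurs {pn V : Type} (alpha : atom) (S : stor pn V) {struct S} : Prop :=
  match S with
  | SPair | SUnit | SLabel _ => False
  | SDown a => aoccurs alpha a
  | SFun P => poccurs alpha P
  end
with koccurs {pn V : Type} (alpha : atom) (T : costor pn V) {struct T} : Prop :=
  match T with
  | KPair P => poccurs alpha P
  | KUnit P => poccurs alpha P
  | KCase L P => exists l, in_labels l L /\ poccurs alpha (P l)
  | KDown P => poccurs alpha P
  | KApp a1 a2 => aoccurs alpha a1 \/ aoccurs alpha a2
  end.

(** ** Signatures *)

(* The body of p(z : C)(x_1 : A_1) ... (x_n : A_n) = P: the variable z is [None]
   and x_{i+1} is [Some i]. *)
Record pdecl (tn pn : Type) := PDecl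
  { pd_result : ty tn;
    pd_params : list (ty tn);
    pd_body : proc pn (option {i : nat | i < length pd_params}) }.

Record signature := Signature
  { tname : Type;
    pname : Type;
    tdef : tname -> ty tname;
    pdef : pname -> pdecl tname pname }.

Inductive unguarded (tn : Type) (u : tn) : ty tn -> Prop :=
| ung_name : unguarded u (TName u)
| ung_tensor1 A1 A2 : unguarded u A1 -> unguarded u (Tensor A1 A2)
| ung_tensor2 A1 A2 : unguarded u A2 -> unguarded u (Tensor A1 A2)
| ung_plus L A l : in_labels l L -> unguarded u (A l) -> unguarded u (Plus L A).

(* A process definition is contractive if unfolding it does not lead to an
   infinite chain of definitions that are mere calls. *)
Definition contractive (Sg : signature) : Prop :=
  well_founded (fun u t : tname Sg => unguarded u (tdef Sg t)) /\
  well_founded (fun q p : pname Sg =>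
                  exists d args, pd_body (pdef Sg p) = Call q d args).

(** ** Equirecursive type equality *)

Inductive unfolds (Sg : signature) : ty (tname Sg) -> ty (tname Sg) -> Prop :=
| unf_refl A : unfolds Sg A A
| unf_name t B : unfolds Sg (tdef Sg t) B -> unfolds Sg (TName t) B.

CoInductive ty_eq (Sg : signature) : ty (tname Sg) -> ty (tname Sg) -> Prop :=
| eq_tensor A B A1 A2 B1 B2 :
    unfolds Sg A (Tensor A1 A2) -> unfolds Sg B (Tensor B1 B2) ->
    ty_eq Sg A1 B1 -> ty_eq Sg A2 B2 -> ty_eq Sg A B
| eq_one A B :
    unfolds Sg A One -> unfolds Sg B One -> ty_eq Sg A B
| eq_plus A B L M A' B' :
    unfolds Sg A (Plus L A') -> unfolds Sg B (Plus M B') ->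
    (forall l, in_labels l L <-> in_labels l M) ->
    (forall l, in_labels l L -> ty_eq Sg (A' l) (B' l)) -> ty_eq Sg A B
| eq_down A B A' B' :
    unfolds Sg A (Down A') -> unfolds Sg B (Down B') ->
    ty_eq Sg A' B' -> ty_eq Sg A B
| eq_arrow A B A1 A2 B1 B2 :
    unfolds Sg A (Arrow A1 A2) -> unfolds Sg B (Arrow B1 B2) ->
    ty_eq Sg A1 B1 -> ty_eq Sg A2 B2 -> ty_eq Sg A B.

(** ** Process typing *)

Inductive mode := Ordinary | Eligible.

Record entry (tn V : Type) := Entry
  { emode : mode;
    eaddr : addr V;
    ety : ty tn }.

Definition ctx (tn V : Type) := list (entry tn V).

Definition eweak {tn V : Type} (e : entry tn V) : entry tn (option V) :=
  Entry (emode e) (aweak (eaddr e)) (ety e).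

Definition cweak {tn V : Type} (G : ctx tn V) : ctx tn (option V) := map eweak G.

(* Contexts are considered up to reordering, and their types up to
   equirecursive equality. *)
Definition entry_eq (Sg : signature) {V : Type} (e f : entry (tname Sg) V) : Prop :=
  emode e = emode f /\ eaddr e = eaddr f /\ ty_eq Sg (ety e) (ety f).

Definition ctx_eq (Sg : signature) {V : Type} (G H : ctx (tname Sg) V) : Prop :=
  exists K, Permutation G K /\ Forall2 (entry_eq Sg) K H.

(* The presupposition of the judgment G |- P :: (c : C); every rule demands it
   of its conclusion, and hence it holds throughout a derivation. *)
Definition presup {tn V : Type} (G : ctx tn V) (c : addr V) : Prop :=
  forall b B, In (Entry Ordinary b B) G -> ~ extends c b.

Inductive typed (Sg : signature) (V : Type) :
  ctx (tname Sg) V -> proc (pname Sg) V -> addr V -> ty (tname Sg) -> Prop :=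
| ty_conv (G G' : ctx (tname Sg) V) P c C C' :
    presup G' c ->
    ctx_eq Sg G G' -> ty_eq Sg C C' ->
    typed Sg G P c C ->
    typed Sg G' P c C'
| ty_weaken (G : ctx (tname Sg) V) P c C a A :
    presup (Entry Ordinary a A :: G) c ->
    typed Sg G P c C ->
    typed Sg (Entry Ordinary a A :: G) P c C
| ty_contract (G : ctx (tname Sg) V) P c C a A :
    presup (Entry Ordinary a A :: G) c ->
    typed Sg (Entry Ordinary a A :: Entry Ordinary a A :: G) P c C ->
    typed Sg (Entry Ordinary a A :: G) P c C
| ty_contract_elig (G : ctx (tname Sg) V) P c C a A :
    presup (Entry Eligible a A :: G) c ->
    typed Sg (Entry Eligible a A :: Entry Ordinary a A :: G) P c C ->
    typed Sg (Entry Eligible a A :: G) P c C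
| ty_cut (G1 G2 : ctx (tname Sg) V) P Q c C A :
    presup (G1 ++ G2) c ->
    typed Sg (cweak G1) P (var None) A ->
    typed Sg (Entry Ordinary (var None) A :: cweak G2) Q (aweak c) C ->
    typed Sg (G1 ++ G2) (Cut P Q) c C
| ty_snip (G1 G2 : ctx (tname Sg) V) P Q a c C A :
    presup (G1 ++ G2) c ->
    typed Sg G1 P a A ->
    typed Sg (Entry Eligible a A :: G2) Q c C ->
    typed Sg (G1 ++ G2) (Snip a P Q) c C
| ty_id (a b : addr V) A :
    presup [Entry Ordinary b A] a ->
    typed Sg [Entry Ordinary b A] (Copy a b) a A
| ty_tensor_ax (a : addr V) A1 A2 :
    presup [Entry Eligible (proj a [Pi1]) A1; Entry Eligible (proj a [Pi2]) A2] a ->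
    typed Sg [Entry Eligible (proj a [Pi1]) A1; Entry Eligible (proj a [Pi2]) A2]
      (Write a SPair) a (Tensor A1 A2)
| ty_tensor_left (G : ctx (tname Sg) V) m a A1 A2 P c C :
    presup (Entry m a (Tensor A1 A2) :: G) c ->
    typed Sg (Entry Ordinary (proj a [Pi1]) A1
              :: Entry Ordinary (proj a [Pi2]) A2 :: G) P c C ->
    typed Sg (Entry m a (Tensor A1 A2) :: G) (Read a (KPair P)) c C
| ty_one_ax (a : addr V) :
    presup ([] : ctx (tname Sg) V) a ->
    typed Sg [] (Write a SUnit) a One
| ty_one_left (G : ctx (tname Sg) V) a P c C :
    presup (Entry Ordinary a One :: G) c ->
    typed Sg G P c C ->
    typed Sg (Entry Ordinary a One :: G) (Read a (KUnit P)) c C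
| ty_plus_ax (a : addr V) L A k :
    in_labels k L ->
    presup [Entry Eligible (proj a [PLab k]) (A k)] a ->
    typed Sg [Entry Eligible (proj a [PLab k]) (A k)]
      (Write a (SLabel k)) a (Plus L A)
(* The branches and the type are indexed by the same set L, possibly listed
   differently. *)
| ty_plus_left (G : ctx (tname Sg) V) m a L M A P c C :
    presup (Entry m a (Plus L A) :: G) c ->
    (forall l, in_labels l L <-> in_labels l M) ->
    (forall l, in_labels l L ->
       typed Sg (Entry Ordinary (proj a [PLab l]) (A l) :: G) (P l) c C) ->
    typed Sg (Entry m a (Plus L A) :: G) (Read a (KCase M P)) c C
| ty_down_ax (a b : addr V) A :
    presup [Entry Ordinary b A] a ->
    typed Sg [Entry Ordinary b A] (Write a (SDown b)) a (Down A)
| ty_down_left (G : ctx (tname Sg) V) m a A P c C :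
    presup (Entry m a (Down A) :: G) c ->
    typed Sg (Entry Ordinary (var None) A :: cweak G) P (aweak c) C ->
    typed Sg (Entry m a (Down A) :: G) (Read a (KDown P)) c C
| ty_arrow_right (G : ctx (tname Sg) V) a A1 A2 P :
    presup G a ->
    typed Sg (Entry Ordinary (var (Some None)) A1 :: cweak (cweak G))
      P (var None) A2 ->
    typed Sg G (Write a (SFun P)) a (Arrow A1 A2)
| ty_arrow_ax (a a1 a2 : addr V) A1 A2 :
    presup [Entry Ordinary a (Arrow A1 A2); Entry Ordinary a1 A1] a2 ->
    typed Sg [Entry Ordinary a (Arrow A1 A2); Entry Ordinary a1 A1]
      (Read a (KApp a1 a2)) a2 A2
| ty_call (p : pname Sg) (c : addr V) args :
    length args = length (pd_params (pdef Sg p)) ->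
    presup (map (fun e => Entry Ordinary (fst e) (snd e))
              (combine args (pd_params (pdef Sg p)))) c ->
    typed Sg (map (fun e => Entry Ordinary (fst e) (snd e))
                (combine args (pd_params (pdef Sg p))))
      (Call p c args) c (pd_result (pdef Sg p)).

(** ** Configurations *)

(* An empty cell occurs only together with the thread that has it as its
   destination; [Thread a P] stands for the pair thread(a,P), cell(a,_). Thus a
   step that fills the cell of a thread consumes the thread and the empty cell. *)
Inductive object (pn : Type) : Type :=
| Thread (a : addr Empty_set) (P : proc pn Empty_set)
| Cell (a : addr Empty_set) (S : stor pn Empty_set).

Definition config (pn : Type) := list (object pn).

Definition is_cell {pn : Type} (o : object pn) : Prop :=
  match o with
  | Thread _ _ => False
  | Cell _ _ => True
  end.

Definition final {pn : Type} (Om : config pn) : Prop := Forall is_cell Om.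

Definition pre_cctx (tn : Type) := list (addr Empty_set * ty tn).

Definition is_cctx {tn : Type} (D : pre_cctx tn) : Prop := NoDup (map fst D).

Definition cctx_eq (Sg : signature) (D D' : pre_cctx (tname Sg)) : Prop :=
  Forall2 (fun e f => fst e = fst f /\ ty_eq Sg (snd e) (snd f)) D D'.

Definition has_entry (Sg : signature) (D : pre_cctx (tname Sg))
    (a : addr Empty_set) (A : ty (tname Sg)) : Prop :=
  exists A', In (a, A') D /\ ty_eq Sg A A'.

Definition has_eligible (Sg : signature) (G : ctx (tname Sg) Empty_set)
    (a : addr Empty_set) (A : ty (tname Sg)) : Prop :=
  exists A', In (Entry Eligible a A') G /\ ty_eq Sg A A'.

Definition provides (Sg : signature) (c : addr Empty_set)
    (D : pre_cctx (tname Sg)) (G : ctx (tname Sg) Empty_set) : Prop :=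
  (forall a A, In (Entry Ordinary a A) G -> has_entry Sg D a A) /\
  (forall a A, In (Entry Eligible a A) G ->
     has_entry Sg D a A /\ strictly_extends a c) /\
  (forall a A, In (a, A) D -> strictly_extends a c ->
     has_eligible Sg G a A \/
     exists b B, In (Entry Eligible b B) G /\ strictly_extends a b).

Inductive ctyped (Sg : signature) :
  pre_cctx (tname Sg) -> config (pname Sg) -> pre_cctx (tname Sg) -> Prop :=
| ct_empty D D' :
    is_cctx D -> cctx_eq Sg D D' ->
    ctyped Sg D [] D'
| ct_join D D' D'' Om1 Om2 :
    ctyped Sg D Om1 D' -> ctyped Sg D' Om2 D'' ->
    ctyped Sg D (Om1 ++ Om2) D''
| ct_thread D a A G P :
    is_cctx D -> ~ In a (map fst D) ->
    provides Sg a D G -> typed Sg G P a A ->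
    ctyped Sg D [Thread a P] (D ++ [(a, A)])
| ct_cell D a A G S :
    is_cctx D -> ~ In a (map fst D) ->
    provides Sg a D G -> typed Sg G (Write a S) a A ->
    ctyped Sg D [Cell a S] (D ++ [(a, A)]).

(** ** Operational semantics *)

Definition ooccurs {pn : Type} (alpha : atom) (o : object pn) : Prop :=
  match o with
  | Thread a P => aoccurs alpha a \/ poccurs alpha P
  | Cell a St => aoccurs alpha a \/ soccurs alpha St
  end.

Definition fresh {pn : Type} (alpha : atom) (Om : config pn) : Prop :=
  ~ Exists (ooccurs alpha) Om.

(* [pass S T P] is the graph of the partial operation taking S and T to P. *)
Inductive pass {pn V : Type} : stor pn V -> costor pn V -> proc pn V -> Prop :=
| pass_pair P : pass SPair (KPair P) P
| pass_unit P : pass SUnit (KUnit P) P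
| pass_label k L P : in_labels k L -> pass (SLabel k) (KCase L P) (P k)
| pass_down a P : pass (SDown a) (KDown P) (psubst (inst1 a) P)
| pass_fun P a1 a2 : pass (SFun P) (KApp a1 a2) (psubst (inst2 a1 a2) P).

Definition call_inst {V : Type} (c : addr V) (args : list (addr V)) {n : nat}
    (v : option {i : nat | i < n}) : addr V :=
  match v with
  | None => c
  | Some i => nth (proj1_sig i) args c
  end.

Inductive step (Sg : signature) : config (pname Sg) -> config (pname Sg) -> Prop :=
| step_perm Om1 Om2 Om1' Om2' :
    Permutation Om1 Om2 -> step Sg Om2 Om2' -> Permutation Om2' Om1' ->
    step Sg Om1 Om1'
| step_cut c P Q alpha Om :
    fresh alpha (Thread c (Cut P Q) :: Om) ->
    step Sg (Thread c (Cut P Q) :: Om)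
      (Thread (runtime alpha) (psubst (inst1 (runtime alpha)) P)
       :: Thread c (psubst (inst1 (runtime alpha)) Q) :: Om)
| step_snip c a P Q Om :
    (forall b, dest P b <-> b = a) ->
    step Sg (Thread c (Snip a P Q) :: Om) (Thread a P :: Thread c Q :: Om)
| step_copy a b S Om :
    step Sg (Thread a (Copy a b) :: Cell b S :: Om) (Cell a S :: Cell b S :: Om)
| step_write a S Om :
    step Sg (Thread a (Write a S) :: Om) (Cell a S :: Om)
| step_read c a T S P Om :
    pass S T P ->
    step Sg (Thread c (Read a T) :: Cell a S :: Om) (Thread c P :: Cell a S :: Om)
| step_call c p args Om :
    length args = length (pd_params (pdef Sg p)) ->
    step Sg (Thread c (Call p c args) :: Om)
      (Thread c (psubst (call_inst c args) (pd_body (pdef Sg p))) :: Om).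

(* Main.v *)
(* A configuration is typed from left to right, so the leftmost thread only
   refers to addresses of filled cells to its left.  Such a cell holds a
   storable of the shape dictated by its type, and hence matches whatever the
   thread does with it.  A snip can always be reduced because a process typed
   with destination c has {c} as its set of destinations. *)

Require Import Defs.
From Stdlib Require Import List Permutation Lia.
Import ListNotations.

(** * Freshness *)

(** Finiteness of a set of atoms, in a form where the bound itself is an atom outside the set. *)
Definition bounded (U : nat -> Prop) : Prop := exists n, forall k, U k -> k < n.

Lemma bounded_False : bounded (fun _ => False).
Proof. exists 0. tauto. Qed.

Lemma bounded_or (U U' : nat -> Prop) :
  bounded U -> bounded U' -> bounded (fun k => U k \/ U' k).
Proof.
  intros [n Hn] [n' Hn']. exists (n + n'). intros k [H|H].
  - specialize (Hn k H). lia.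
  - specialize (Hn' k H). lia.
Qed.

(** Meant for the branches of a case: they are a function on all labels, and only the restriction to
    a finite index set keeps the union of their atoms bounded. *)
Lemma bounded_exists_in {X : Type} (U : nat -> X -> Prop) (l : list X) :
  (forall x, bounded (fun k => U k x)) ->
  bounded (fun k => exists x, In x l /\ U k x).
Proof.
  intros HU. induction l as [|x l [n' Hn']].
  - exists 0. intros k (y & [] & _).
  - destruct (HU x) as [n Hn]. exists (n + n'). intros k (y & [<-|Hy] & HUy).
    + specialize (Hn k HUy). lia.
    + specialize (Hn' k (ex_intro _ y (conj Hy HUy))). lia.
Qed.

Lemma bounded_Exists {X : Type} (U : nat -> X -> Prop) (l : list X) :
  (forall x, bounded (fun k => U k x)) -> bounded (fun k => Exists (U k) l).
Proof.
  intros HU. destruct (bounded_exists_in U l HU) as [n Hn].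
  exists n. intros k Hk. apply Hn. now apply Exists_exists.
Qed.

Lemma bounded_aoccurs {V : Type} (a : addr V) : bounded (fun k => aoccurs k a).
Proof.
  destruct a as [[x|m] p]; unfold aoccurs; simpl.
  - exists 0. intros k [=].
  - exists (S m). intros k [= ->]. lia.
Qed.

Scheme proc_mut := Induction for proc Sort Prop
with stor_mut := Induction for stor Sort Prop
with costor_mut := Induction for costor Sort Prop.

Lemma bounded_poccurs {pn V : Type} (P : proc pn V) : bounded (fun k => poccurs k P).
Proof.
  induction P using proc_mut
    with (P0 := fun V (S : stor pn V) => bounded (fun k => soccurs k S))
         (P1 := fun V (T : costor pn V) => bounded (fun k => koccurs k T));
    simpl; auto using bounded_or, bounded_False, bounded_aoccurs.
  - apply bounded_or; [apply bounded_aoccurs|].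
    apply bounded_Exists. intros; apply bounded_aoccurs.
  - now apply bounded_exists_in.
Qed.

Lemma bounded_soccurs {pn V : Type} (S : stor pn V) : bounded (fun k => soccurs k S).
Proof.
  destruct S; simpl;
    auto using bounded_False, bounded_aoccurs, bounded_poccurs.
Qed.

Lemma fresh_exists {pn : Type} (Om : config pn) : exists alpha, fresh alpha Om.
Proof.
  destruct (bounded_Exists ooccurs Om) as [n Hn].
  - intros [a P|a S]; apply bounded_or;
      auto using bounded_aoccurs, bounded_poccurs, bounded_soccurs.
  - exists n. intros H. specialize (Hn n H). lia.
Qed.

(** * Destinations *)

Lemma aweak_inj {V : Type} (a b : addr V) : aweak a = aweak b -> a = b.
Proof.
  destruct a as [[x|m] p], b as [[y|n] q]; unfold aweak, asubst, proj; simpl;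
    intros [=]; subst; reflexivity.
Qed.

Lemma labels_inhabited (L : labels) : exists l, in_labels l L.
Proof.
  destruct L as [[|l L] HL]; [now contradiction HL|]. exists l. now left.
Qed.

(** Structural rules keep the process, continuations keep the destination (weakened under a binder),
    and every leaf writes to its own destination. This yields the side condition of [step_snip]. *)
Lemma typed_dest {Sg : signature} {V : Type} {G : ctx (tname Sg) V} {P c C} :
  typed Sg G P c C -> forall b, dest P b <-> b = c.
Proof.
  induction 1 as [| | | | V G1 G2 P Q c C A _ _ _ _ IHQ | | | | | | |
    | V G m a L M A P c C _ HLM _ IH | | V G m a A P c C _ _ IH | | | ];
    intros d; simpl; auto; try tauto.
  - rewrite IHQ. split; [apply aweak_inj|now intros ->].
  - split.
    + intros (l & Hl & Hd). apply HLM in Hl. now apply (IH l Hl).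
    (* Some branch must actually write to the destination; nonemptiness of the index set supplies
       one. *)
    + intros ->. destruct (labels_inhabited M) as [l Hl].
      exists l. split; [assumption|]. apply HLM in Hl. now apply (IH l Hl).
  - rewrite IH. split; [apply aweak_inj|now intros ->].
Qed.

(** * Canonical forms *)

Definition is_name {tn : Type} (A : ty tn) : Prop :=
  match A with TName _ => True | _ => False end.

(** Unfolding only replaces a name at the head, so it follows a single chain, which stops at the
    first type that is not a name. *)
Lemma unfolds_det {Sg : signature} {A B C : ty (tname Sg)} :
  unfolds Sg A B -> unfolds Sg A C -> ~ is_name B -> ~ is_name C -> B = C.
Proof.
  intros HB; revert C. induction HB as [A|t B HB IH]; intros C HC NB NC.
  - inversion HC; subst; [reflexivity|]. now contradiction NB.
  - inversion HC; subst; [now contradiction NC|]. now apply IH.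
Qed.

Ltac unify_unfoldings :=
  repeat match goal with
  | H1 : unfolds _ ?A ?B, H2 : unfolds _ ?A ?C |- _ =>
      let E := fresh "E" in
      (* On a type with a head constructor, [~ is_name] reduces to [False -> False], which the
         identity proves. *)
      pose proof (unfolds_det H1 H2 (fun f => f) (fun f => f)) as E;
      clear H2; try discriminate E; try (injection E as; subst)
  end.

(** Retains only what [pass] inspects, namely the head constructor and the chosen label; the types
    of the components are forgotten. *)
Definition canonical {Sg : signature} {pn V : Type} (S : stor pn V)
    (A : ty (tname Sg)) : Prop :=
  match S with
  | SPair => exists A1 A2, unfolds Sg A (Tensor A1 A2)
  | SUnit => unfolds Sg A One
  | SLabel k => exists L A', unfolds Sg A (Plus L A') /\ in_labels k L
  | SDown _ => exists A', unfolds Sg A (Down A')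
  | SFun _ => exists A1 A2, unfolds Sg A (Arrow A1 A2)
  end.

Definition cocanonical {Sg : signature} {pn V : Type} (T : costor pn V)
    (A : ty (tname Sg)) : Prop :=
  match T with
  | KPair _ => exists A1 A2, unfolds Sg A (Tensor A1 A2)
  | KUnit _ => unfolds Sg A One
  | KCase M _ => exists L A', unfolds Sg A (Plus L A') /\
                   forall l, in_labels l L <-> in_labels l M
  | KDown _ => exists A', unfolds Sg A (Down A')
  | KApp _ _ => exists A1 A2, unfolds Sg A (Arrow A1 A2)
  end.

(** Equal types unfold to the same head constructor, and by [unfolds_det] it is the one that
    [canonical S A] mentions. *)
Lemma canonical_ty_eq {Sg : signature} {pn V : Type} (S : stor pn V)
    (A B : ty (tname Sg)) :
  ty_eq Sg A B -> canonical S A -> canonical S B.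
Proof.
  destruct 1; destruct S; simpl; intros HS;
    repeat match goal with
    | H : exists _, _ |- _ => destruct H
    | H : _ /\ _ |- _ => destruct H
    end; unify_unfoldings; eauto.
  do 2 eexists. split; [eassumption|]. firstorder.
Qed.

Lemma cocanonical_ty_eq {Sg : signature} {pn V : Type} (T : costor pn V)
    (A B : ty (tname Sg)) :
  ty_eq Sg A B -> cocanonical T A -> cocanonical T B.
Proof.
  destruct 1; destruct T; simpl; intros HT;
    repeat match goal with
    | H : exists _, _ |- _ => destruct H
    | H : _ /\ _ |- _ => destruct H
    end; unify_unfoldings; eauto.
  do 2 eexists. split; [eassumption|]. firstorder.
Qed.

Lemma canonical_pass {Sg : signature} {pn V : Type} (S : stor pn V)
    (T : costor pn V) (A : ty (tname Sg)) :
  canonical S A -> cocanonical T A -> exists P, pass S T P.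
Proof.
  destruct S, T; simpl; intros HS HT;
    repeat match goal with
    | H : exists _, _ |- _ => destruct H
    | H : _ /\ _ |- _ => destruct H
    end; unify_unfoldings; try (eexists; constructor).
  (* What remains is the premise of [pass_label]: the stored label lies in the index set of the
     type, hence in that of the branches. *)
  firstorder.
Qed.

(** * Inversion of process typing *)

(* The alternative [A = B] is needed as [ty_eq] need not be reflexive on
   non-contractive types. *)
Definition ty_sub (Sg : signature) (A B : ty (tname Sg)) : Prop :=
  A = B \/ ty_eq Sg A B.

(** Modes and multiplicities are ignored so that, for weakening, both contractions and conversion
    alike, the context of the conclusion covers that of the premise. *)
Definition covered {Sg : signature} {V : Type} (G H : ctx (tname Sg) V) : Prop :=
  forall m a A, In (Entry m a A) G ->
  exists m' A', In (Entry m' a A') H /\ ty_sub Sg A A'.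

Lemma covered_incl {Sg : signature} {V : Type} (G H : ctx (tname Sg) V) :
  incl G H -> covered G H.
Proof. intros HI m a A HIn. exists m, A. split; [auto|now left]. Qed.

Lemma covered_ctx_eq {Sg : signature} {V : Type} (G H : ctx (tname Sg) V) :
  ctx_eq Sg G H -> covered G H.
Proof.
  intros (K & HP & HF) m a A HIn.
  apply (Permutation_in _ HP) in HIn. clear HP G.
  induction HF as [|[m1 a1 A1] [m2 a2 A2] K H (E1 & E2 & E3) HF IH];
    simpl in *; [easy|].
  destruct HIn as [[= -> -> ->]|HIn].
  - subst. exists m2, A2. split; [now left|now right].
  - destruct (IH HIn) as (m' & A' & ? & ?). exists m', A'. auto.
Qed.

(** Collects what a step of each form of process requires, weak enough to survive the structural
    rules. *)
Definition inverted {Sg : signature} {V : Type} (G : ctx (tname Sg) V)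
    (P : proc (pname Sg) V) (c : addr V) (C : ty (tname Sg)) : Prop :=
  match P with
  | Cut _ _ => True
  | Snip a P _ => forall b, dest P b <-> b = a
  | Copy a b => a = c /\ exists m A, In (Entry m b A) G
  | Write a St => a = c /\ canonical St C
  | Read a T => exists m A, In (Entry m a A) G /\ cocanonical T A
  | Call p d args => d = c /\ length args = length (pd_params (pdef Sg p))
  end.

Lemma inverted_covered {Sg : signature} {V : Type} (G G' : ctx (tname Sg) V)
    P c (C C' : ty (tname Sg)) :
  covered G G' -> ty_sub Sg C C' -> inverted G P c C -> inverted G' P c C'.
Proof.
  intros HG HC. destruct P; simpl; auto.
  - intros (-> & m & A & HIn). split; [reflexivity|].
    destruct (HG _ _ _ HIn) as (m' & A' & ? & _). eauto.
  - intros [-> HS]. split; [reflexivity|].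
    destruct HC as [<-|HC]; eauto using canonical_ty_eq.
  - intros (m & A & HIn & HT).
    destruct (HG _ _ _ HIn) as (m' & A' & HIn' & HA).
    exists m', A'. split; [assumption|].
    destruct HA as [<-|HA]; eauto using cocanonical_ty_eq.
Qed.

Lemma typed_inverted {Sg : signature} {V : Type} {G : ctx (tname Sg) V} {P c C} :
  typed Sg G P c C -> inverted G P c C.
Proof.
  induction 1 as [| V G P c C a A _ _ IH | V G P c C a A _ _ IH
    | V G P c C a A _ _ IH | | V G1 G2 P Q a c C A _ HP | | | | |
    | V a L A k Hk | V G m a L M A P c C _ HLM | | | | | ];
    simpl; eauto 7 using unf_refl.
  - eapply inverted_covered;
      [eapply covered_ctx_eq; eassumption|right; eassumption|assumption].
  - eapply inverted_covered; [|now left|exact IH].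
    apply covered_incl. now intros e He; right.
  - eapply inverted_covered; [|now left|exact IH].
    apply covered_incl. intros e [<-|He]; [now left|assumption].
  - eapply inverted_covered; [|now left|exact IH].
    intros m b B [[= <- <- <-]|[[= <- <- <-]|HIn]].
    + exists Eligible, A. split; [now left|now left].
    (* The ordinary copy that the contraction removes is covered by the eligible entry that
       stays. *)
    + exists Eligible, A. split; [now left|now left].
    + exists m, B. split; [now right|now left].
  - exact (typed_dest HP).
  - do 2 eexists. split; [now left|]. do 2 eexists.
    split; [apply unf_refl|exact HLM].
Qed.

(** * Progress *)

(** The invariant carried from left to right: the shape of each stored value is remembered, not its
    typing derivation. *)
Definition filled {Sg : signature} (Om : config (pname Sg))
    (D : pre_cctx (tname Sg)) : Prop :=
  forall a A, In (a, A) D -> exists S, In (Cell a S) Om /\ canonical S A.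

Lemma filled_app {Sg : signature} (Om Om' : config (pname Sg)) D D' :
  filled Om D -> filled Om' D' -> filled (Om ++ Om') (D ++ D').
Proof.
  intros HD HD' a A HIn. apply in_app_or in HIn as [HIn|HIn].
  - destruct (HD a A HIn) as (S & ? & ?). eauto using in_or_app.
  - destruct (HD' a A HIn) as (S & ? & ?). eauto using in_or_app.
Qed.

Lemma filled_cctx_eq {Sg : signature} (Om : config (pname Sg)) D D' :
  cctx_eq Sg D D' -> filled Om D -> filled Om D'.
Proof.
  induction 1 as [|[a A] [b B] D D' [E HE] HF IH]; intros HD c C HIn; [easy|].
  simpl in E, HE. subst b. destruct HIn as [[= <- <-]|HIn].
  - destruct (HD a A (or_introl eq_refl)) as (S & ? & ?).
    eauto using canonical_ty_eq.
  - apply IH; [|assumption]. intros c' C' HIn'. apply HD. now right.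
Qed.

Lemma filled_provided {Sg : signature} (Om : config (pname Sg)) c D G m a A :
  filled Om D -> provides Sg c D G -> In (Entry m a A) G ->
  exists S A', In (Cell a S) Om /\ ty_eq Sg A A' /\ canonical S A'.
Proof.
  intros HD (HO & HE & _) HIn.
  assert (has_entry Sg D a A) as (A' & HIn' & HA).
  { destruct m; [now apply HO|now apply HE]. }
  destruct (HD a A' HIn') as (S & ? & ?). eauto.
Qed.

(** [Om0] is the filled part that types the thread, [Om] everything beside the thread. An address
    copied from or read has an entry in [G], hence one in [D], hence a cell in [Om0]. *)
Lemma thread_step {Sg : signature} (Om0 Om : config (pname Sg)) D G c P C :
  filled Om0 D -> provides Sg c D G -> typed Sg G P c C -> incl Om0 Om ->
  exists Om', step Sg (Thread c P :: Om) Om'.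
Proof.
  intros HD HG HP HI. apply typed_inverted in HP.
  (* The rules for copying and reading expect the cell right behind the thread, so it is moved to
     the front of [Om]. *)
  assert (Hcell : forall a S, In (Cell a S) Om0 ->
            exists Om1, Permutation (Cell a S :: Om1) Om).
  { intros a S HIn. apply HI, in_split in HIn as (l1 & l2 & ->).
    exists (l1 ++ l2). apply Permutation_middle. }
  destruct P as [P Q|a P Q|a b|a S|a T|p d args]; simpl in HP.
  - destruct (fresh_exists (Thread c (Cut P Q) :: Om)) as [alpha Ha].
    eexists. now apply step_cut with (alpha := alpha).
  - eexists. now apply step_snip.
  - destruct HP as (-> & m & A & HIn).
    destruct (filled_provided Om0 c D G m b A HD HG HIn) as (S & _ & HS & _).
    destruct (Hcell b S HS) as [Om1 HOm].
    eexists. eapply step_perm; [|apply step_copy|apply Permutation_refl].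
    apply perm_skip, Permutation_sym, HOm.
  - destruct HP as [-> _]. eexists. apply step_write.
  - destruct HP as (m & A & HIn & HT).
    destruct (filled_provided Om0 c D G m a A HD HG HIn)
      as (S & A' & HS & HA & HC).
    destruct (Hcell a S HS) as [Om1 HOm].
    destruct (canonical_pass S T A' HC (cocanonical_ty_eq T A A' HA HT)) as [P HP].
    eexists. eapply step_perm; [|apply step_read; exact HP|apply Permutation_refl].
    apply perm_skip, Permutation_sym, HOm.
  - destruct HP as [-> Hlen]. eexists. now apply step_call.
Qed.

(* The frame [F] is quantified inside because, owing to the freshness condition
   of a cut, steps are not closed under adding objects. *)
Lemma ctyped_progress {Sg : signature} (Om0 Om : config (pname Sg)) D D' :
  ctyped Sg D Om D' -> filled Om0 D ->
  (final Om /\ filled (Om0 ++ Om) D') \/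
  (forall F, exists Om', step Sg (Om0 ++ Om ++ F) Om').
Proof.
  intros HOm; revert Om0.
  induction HOm as [D D' _ HD | D D' D'' Om1 Om2 _ IH1 _ IH2
    | D a A G P _ _ HG HP | D a A G S _ _ HG HS]; intros Om0 H0.
  - left. rewrite app_nil_r. split; [constructor|]. eauto using filled_cctx_eq.
  - destruct (IH1 Om0 H0) as [[HF1 HD1]|Hstep].
    (* Once [Om1] is final, [Om0 ++ Om1] serves as the filled prefix for [Om2]. *)
    + destruct (IH2 _ HD1) as [[HF2 HD2]|Hstep].
      * left. split; [now apply Forall_app|]. now rewrite app_assoc.
      * right. intros F. destruct (Hstep F) as [Om' H].
        exists Om'. rewrite <- !app_assoc in *. exact H.
    (* When [Om1] can step, [Om2] becomes part of its frame. *)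
    + right. intros F. destruct (Hstep (Om2 ++ F)) as [Om' H].
      exists Om'. now rewrite <- app_assoc.
  - right. intros F.
    destruct (thread_step Om0 (Om0 ++ F) D G a P A H0 HG HP) as [Om' H].
    { apply incl_appl, incl_refl. }
    exists Om'. eapply step_perm; [|exact H|apply Permutation_refl].
    apply Permutation_sym, Permutation_middle.
  - left. split; [now repeat constructor|]. apply filled_app; [assumption|].
    intros b B [[= <- <-]|[]]. exists S. split; [now left|].
    (* A filled cell is typed as a write, so inversion gives the shape of its content. *)
    exact (proj2 (typed_inverted HS)).
Qed.

Theorem theorem3p2 (Sg : signature) (HSg : contractive Sg)
  (Om : config (pname Sg)) (D : pre_cctx (tname Sg)) (HD : is_cctx D) :
  ctyped Sg [] Om D ->
  final Om \/ exists Om' : config (pname Sg), step Sg Om Om'.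
Proof.
  intros HOm.
  destruct (ctyped_progress [] Om [] D HOm) as [[HF _]|Hstep].
  - intros a A [].
  - now left.
  - right. destruct (Hstep []) as [Om' H]. exists Om'.
    now rewrite app_nil_r in H.
Qed.
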